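(* Let $p$ be a prime with $p\equiv1\pmod 4$, and let $q=p_{*}^{t}$ ($t\geq1$) be a power of a prime $p_{*}$ with $p\nmid p_{*}$. If $q$ is a quadratic residue modulo $p$, then there exists an asymmetric quantum code $[[tp,\ t,\ d_z/d_x]]_{p_{*}}$ with $d_z\geq\sqrt{p}$ and $d_x\geq\sqrt{p}$.
   Context: An AQECC $[[n,k,d_z/d_x]]_{r}$ over a prime power alphabet size $r$ is an $r^k$-dimensional subspace of $\mathbb{C}^{r^n}$ correcting all qudit-flip errors up to $\lfloor (d_x-1)/2\rfloor$ and all phase-shift errors up to $\lfloor (d_z-1)/2\rfloor$. *)

(* Defs.v *)
From mathcomp Require Import all_boot all_order all_algebra all_field.
Set Implicit Arguments. Unset Strict Implicit. Unset Printing Implicit Defensive.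
Import Order.TTheory GRing.Theory Num.Theory.
Local Open Scope ring_scope.

(* Computational basis labels of n qudits over the prime alphabet F_r. *)
Definition qstate (n r : nat) := {ffun 'I_n -> 'F_r}.

(* Hilbert space C^{r^n}, as row vectors indexed by basis labels. *)
Definition Hvec (n r : nat) := 'rV[algC]_#|{: qstate n r}|.

Definition amp n r (u : Hvec n r) (x : qstate n r) : algC := u 0 (enum_rank x).
Definition mkvec n r (f : qstate n r -> algC) : Hvec n r := \row_j f (enum_val j).

(* a fixed primitive r-th root of unity (for r >= 1) *)
Definition omega (r : nat) : algC := sval (C_prim_root_exists (ltn0Sn r.-1)).

Definition wt n r (a : qstate n r) : nat := #|[set i | a i != 0]|.

Definition dotF n r (b x : qstate n r) : 'F_r := \sum_i b i * x i.

(* qudit-flip X(a)|x> = |x+a>  and phase-shift Z(b)|x> = omega^{b.x}|x> *)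
Definition Xop n r (a : qstate n r) (u : Hvec n r) : Hvec n r :=
  mkvec (fun x => amp u (x - a)).
Definition Zop n r (b : qstate n r) (u : Hvec n r) : Hvec n r :=
  mkvec (fun x => omega r ^+ (nat_of_ord (dotF b x)) * amp u x).

Definition herm n r (u v : Hvec n r) : algC :=
  \sum_x (amp u x)^* * amp v x.

(* Q (row space of the matrix Q) is an asymmetric quantum code
   [[n,k,dz/dx]]_r: a subspace of dimension r^k of C^{r^n} correcting all
   errors X(a)Z(b) with wt a <= (dx-1)/2 and wt b <= (dz-1)/2, in the
   Knill--Laflamme sense: <E1 u | E2 v> = c(E1,E2) <u|v> for all u,v in Q. *)
Definition is_AQECC (n k r dz dx : nat) (Q : 'M[algC]_#|{: qstate n r}|) : Prop :=
  \rank Q = (r ^ k)%N /\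
  forall a1 b1 a2 b2 : qstate n r,
    (wt a1 <= (dx.-1)./2)%N -> (wt b1 <= (dz.-1)./2)%N ->
    (wt a2 <= (dx.-1)./2)%N -> (wt b2 <= (dz.-1)./2)%N ->
    exists c : algC, forall u v : Hvec n r, (u <= Q)%MS -> (v <= Q)%MS ->
      herm (Xop a1 (Zop b1 u)) (Xop a2 (Zop b2 v)) = c * herm u v.
Arguments is_AQECC n k r dz dx Q : clear implicits.

(* Main.v *)
From HB Require Import structures.
Require Import Defs.
From mathcomp Require Import all_boot all_order all_algebra all_solvable all_field.
From mathcomp Require Import ring.

(* CSS construction on quadratic residue codes. Let q = ps ^ t, let L be a
   finite field of order q ^ (p - 1) with a primitive p-th root of unity, and
   let e be an F_ps-basis of the subfield F_q. Grouping the coordinates of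
   F_ps^(tp) by t and using e turns a state label into a word over F_q of
   length p. The code C1 consists of the words whose Fourier transform vanishes
   at the nonzero residues, and C2 of those for which it also vanishes at 0;
   C1 is C2 plus the constant words, so C1/C2 has order q.

   A word of C1 outside C2, convolved with its dilation by a nonresidue, is a
   nonzero constant, so the square of its weight is at least p.

   For the dual distance, a functional on F_ps^(tp) is written at each of the p
   places as a linearised polynomial with t coefficients. As q is a residue, C2
   contains the words of traces Tr (x zeta^(- n i)) for x in L and n a
   nonresidue; a functional killing them gives a polynomial identity in x of
   degree smaller than the order of L, so each of its t coefficient words has a
   Fourier transform vanishing on a coset of the residues, and the same
   convolution argument applies. *)

(** * Powers of a root of unity of prime order *)

Section PrimeOrderRoots.
Set Implicit Arguments. Unset Strict Implicit.
Import GRing.Theory.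
Local Open Scope ring_scope.

Variables (R : nzRingType) (p : nat) (w : R).
Hypotheses (p_pr : prime p) (w_prim : p.-primitive_root w).
Implicit Types i j : 'F_p.

Lemma prim_root_expFpD i j : w ^+ (i + j)%R = w ^+ i * w ^+ j.
Proof.
rewrite -exprD -[RHS](prim_expr_mod w_prim) /=.
by congr (_ ^+ (_ %% _)); rewrite Fp_cast.
Qed.

Lemma prim_root_expFp_eq1 i : (w ^+ i == 1) = (i == 0).
Proof.
rewrite -(prim_order_dvd w_prim); apply/idP/eqP => [|->]; last exact: dvdn0.
have := ltn_ord i; rewrite {2}Fp_cast // => lt_p.
by rewrite /dvdn modn_small // => /eqP i0; apply: val_inj.
Qed.

End PrimeOrderRoots.

(** * CSS codes from nested additive groups [D2] and [D1] *)

Section CSS.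
Set Implicit Arguments. Unset Strict Implicit.
Import Order.TTheory GRing.Theory Num.Theory.
Local Open Scope ring_scope.

Variables (n r : nat).
Hypothesis r_pr : prime r.

Implicit Types (a b x y : qstate n r) (u v : Hvec n r).

Lemma omega_prim : r.-primitive_root (omega r).
Proof.
rewrite /omega; case: (C_prim_root_exists _) => w /=.
by rewrite prednK ?prime_gt0.
Qed.

Definition phase b x : algC := omega r ^+ (dotF b x).

Lemma phaseDr b x y : phase b (x + y) = phase b x * phase b y.
Proof.
rewrite /phase -(prim_root_expFpD r_pr omega_prim); congr (omega r ^+ nat_of_ord _).
by rewrite -big_split; apply: eq_bigr => i _; rewrite ffunE mulrDr.
Qed.

Lemma phaseDl a b x : phase (a + b) x = phase a x * phase b x.
Proof.
rewrite /phase -(prim_root_expFpD r_pr omega_prim); congr (omega r ^+ nat_of_ord _).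
by rewrite -big_split; apply: eq_bigr => i _; rewrite ffunE mulrDl.
Qed.

Lemma norm_phase b x : `|phase b x| = 1.
Proof.
rewrite normrX; have r0 := prime_gt0 r_pr.
have /eqP := congr1 Num.norm (prim_expr_order omega_prim).
by rewrite normr1 normrX pexpr_eq1 // => /eqP ->; rewrite expr1n.
Qed.

Lemma conj_phase_mul b1 b2 x :
  (phase b1 x)^* * phase b2 x = phase (b2 - b1) x.
Proof.
rewrite -{1}[b2](subrK b1) (phaseDl (b2 - b1)) mulrCA -normCKC norm_phase.
by rewrite expr1n mulr1.
Qed.

Lemma phase_eq1 b x : (phase b x == 1) = (dotF b x == 0).
Proof. exact: prim_root_expFp_eq1 r_pr omega_prim _. Qed.

Lemma amp_mkvec (f : qstate n r -> algC) x : amp (mkvec f) x = f x.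
Proof. by rewrite /amp mxE enum_rankK. Qed.

Lemma wtB a b : (wt (a - b)%R <= wt a + wt b)%N.
Proof.
rewrite /wt; apply: leq_trans (leq_card_setU _ _); apply: subset_leq_card.
apply/subsetP => i; rewrite !inE !ffunE -negb_and; apply: contra.
by case/andP => /eqP -> /eqP ->; rewrite subr0.
Qed.

Variables D1 D2 : {set qstate n r}.
Hypothesis D1B : forall x y, x \in D1 -> y \in D1 -> x - y \in D1.
Hypothesis D2B : forall x y, x \in D2 -> y \in D2 -> x - y \in D2.
Hypothesis D20 : 0 \in D2.
Hypothesis D21 : D2 \subset D1.

(** This is the span of the uniform superpositions over cosets of [D2] inside [D1]; error correction
    is checked on this whole space. *)
Definition css_vec u :=
  (forall x, x \notin D1 -> amp u x = 0) /\
  (forall x y, y \in D2 -> amp u (x + y) = amp u x).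

(** Up to a scalar the two errors combine into a shift by [a1 - a2] and a phase [b2 - b1]. A shift
    outside [D1] makes the supports disjoint, while one in [D2] fixes [v]. A phase trivial on [D2]
    is trivial on [D1] by hypothesis; any other phase cancels over the cosets of [D2]. *)
Lemma css_KL a1 b1 a2 b2 :
    (a1 - a2 \in D1 -> a1 - a2 \in D2) ->
    ((forall x, x \in D2 -> dotF (b2 - b1) x = 0) ->
     forall x, x \in D1 -> dotF (b2 - b1) x = 0) ->
  exists c : algC, forall u v, css_vec u -> css_vec v ->
    herm (Xop a1 (Zop b1 u)) (Xop a2 (Zop b2 v)) = c * herm u v.
Proof.
move=> HX HZ.
have E u v : herm (Xop a1 (Zop b1 u)) (Xop a2 (Zop b2 v)) =
    phase b2 (a1 - a2) * \sum_x phase (b2 - b1) x *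
      ((amp u x)^* * amp v (x + (a1 - a2))).
  rewrite /herm (reindex_inj (addIr a1)) mulr_sumr; apply: eq_bigr => x _.
  rewrite /Xop /Zop !amp_mkvec addrK -addrA.
  rewrite -!/(phase _ _) (phaseDr b2 x) rmorphM -conj_phase_mul /=.
  by ring.
have [aD1|aD1] := boolP (a1 - a2 \in D1); last first.
  exists 0 => u v [u1 u2] [v1 v2]; rewrite E mul0r big1 ?mulr0 // => x _.
  have [xD|xD] := boolP (x \in D1); last by rewrite u1 // conjC0 mul0r mulr0.
  rewrite v1 ?mulr0 //; apply: contra aD1 => h.
  by have := D1B h xD; rewrite addrC addKr.
have aD2 := HX aD1.
have {}E u v : css_vec v -> herm (Xop a1 (Zop b1 u)) (Xop a2 (Zop b2 v)) =
    phase b2 (a1 - a2) * \sum_x phase (b2 - b1) x * ((amp u x)^* * amp v x).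
  by case=> _ v2; rewrite E; congr (_ * _); apply: eq_bigr => x _; rewrite v2.
have [/forall_inP b0|] := boolP [forall x in D2, dotF (b2 - b1) x == 0].
  have {}b0 := HZ (fun x h => eqP (b0 x h)).
  exists (phase b2 (a1 - a2)) => u v [u1 u2] hv; rewrite E //; congr (_ * _).
  apply: eq_bigr => x _.
  have [xD|xD] := boolP (x \in D1); last by rewrite u1 // conjC0 mul0r mulr0.
  by rewrite /phase b0 // mul1r.
case/forall_inPn => y yD2 b0.
exists 0 => u v [u1 u2] hv; rewrite E // mul0r.
set S := \sum_x _; suff -> : S = 0 by rewrite mulr0.
(* Translation by [y] preserves both amplitudes and multiplies the sum by a phase different from
   1. *)
have : S = phase (b2 - b1) y * S.
  rewrite {1}/S (reindex_inj (addIr y)) mulr_sumr; apply: eq_bigr => x _.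
  by rewrite phaseDr u2 // (proj2 hv) // mulrAC mulrC mulrA.
move/eqP; rewrite -subr_eq0 -{1}[S]mul1r -mulrBl mulf_eq0 subr_eq0 eq_sym.
by rewrite phase_eq1 (negPf b0) => /eqP.
Qed.

(** The map [s] picks representatives of distinct cosets of [D2] in [D1]. The indicators of these
    cosets have disjoint supports, hence span a space of dimension [#|M|]. *)
Lemma css_code (k dz dx : nat) (M : finType) (s : M -> qstate n r) :
    (0 < dz)%N -> (0 < dx)%N ->
    #|M| = (r ^ k)%N ->
    (forall m, s m \in D1) ->
    (forall m m', s m - s m' \in D2 -> m = m') ->
    (forall a, a \in D1 -> (wt a < dx)%N -> a \in D2) ->
    (forall b, (forall x, x \in D2 -> dotF b x = 0) -> (wt b < dz)%N ->
      forall x, x \in D1 -> dotF b x = 0) ->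
  exists Q, is_AQECC n k r dz dx Q.
Proof.
move=> dz0 dx0 cardM sD1 s_inj HX HZ.
pose E : 'M[algC]_(#|M|, #|{: qstate n r}|) :=
  \matrix_(i < _, j < _) ((enum_val j : qstate n r) - s (enum_val i : M) \in D2)%:R.
have ampE w x : amp (w *m E) x = \sum_i w 0 i * (x - s (enum_val i) \in D2)%:R.
  by rewrite /amp mxE; apply: eq_bigr => i _; rewrite mxE enum_rankK.
have D2N x : x \in D2 -> - x \in D2 by move=> h; rewrite -sub0r D2B.
have D2D x y : y \in D2 -> (x + y \in D2) = (x \in D2).
  move=> yD; apply/idP/idP => h; first by rewrite -[x](addrK y) D2B.
  by rewrite -[y]opprK D2B // D2N.
have E_free : row_free E.
  apply: inj_row_free => w wE0; apply/rowP => i; rewrite mxE.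
  (* At the representative of coset [i] only row [i] is nonzero, so the amplitude there is
     [w 0 i]. *)
  have := ampE w (s (enum_val i)); rewrite wE0 /amp mxE (bigD1 i) //=.
  rewrite subrr D20 mulr1 big1 ?addr0 // => j ne_ji.
  case: (boolP (_ \in D2)) => [/s_inj/enum_val_inj ij|]; last by rewrite mulr0.
  by rewrite ij eqxx in ne_ji.
exists <<E>>%MS; split.
  by rewrite mxrank_gen -cardM; apply/eqP.
have QP u : (u <= <<E>>)%MS -> css_vec u.
  rewrite genmxE => /submxP[w ->]; split=> [x xD|x y yD]; rewrite !ampE.
    rewrite big1 // => i _; case: (boolP (_ \in D2)) => [h|]; last by rewrite mulr0.
    case/negP: xD; rewrite -[x](subrK (s (enum_val i))) -[X in _ + X]opprK.
    by apply: D1B; [exact: subsetP h | rewrite -sub0r D1B // (subsetP D21)].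
  by apply: eq_bigr => i _; rewrite addrAC (D2D _ y).
(* The Knill-Laflamme condition compares two correctable errors, whose difference has weight at most
   [d - 1]. *)
have half d i j : (0 < d)%N ->
    (i <= d.-1./2)%N -> (j <= d.-1./2)%N -> (i + j < d)%N.
  move=> d0 hi hj; rewrite -[d]prednK // ltnS.
  apply: leq_trans (leq_add hi hj) _; rewrite addnn.
  by rewrite -[X in (_ <= X)%N](odd_double_half d.-1) leq_addl.
move=> a1 b1 a2 b2 wa1 wb1 wa2 wb2.
have [|b0 x xD|c cP] := @css_KL a1 b1 a2 b2.
- by move=> aD; apply: HX aD _; apply: leq_ltn_trans (wtB _ _) (half _ _ _ dx0 _ _).
- by apply: HZ b0 _ x xD; apply: leq_ltn_trans (wtB _ _) (half _ _ _ dz0 _ _).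
by exists c => u v /QP hu /QP hv; apply: cP.
Qed.

End CSS.

(** * Linearised polynomials and the relative trace *)

Section LinearisedPolynomials.
Set Implicit Arguments. Unset Strict Implicit.
Import GRing.Theory.
Local Open Scope ring_scope.

(** A polynomial with more roots than its degree is zero; injectivity of [m] keeps each [v i] as a
    separate coefficient. *)
Lemma sparse_poly_eq0 (F : idomainType) (I : finType) (m : I -> nat)
    (v : I -> F) (rs : seq F) :
    injective m -> (forall i, m i < size rs)%N -> uniq rs ->
    (forall x, x \in rs -> \sum_i v i * x ^+ m i = 0) ->
  forall i, v i = 0.
Proof.
move=> m_inj m_lt rs_uniq v0 i.
pose P : {poly F} := \sum_i v i *: 'X^(m i).
have P0 : P = 0.
  apply/eqP; apply: contraT => nzP.
  suff /(max_poly_roots nzP)/(_ rs_uniq) : all (root P) rs.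
    rewrite ltnNge => /negP[].
    apply: leq_trans (size_sum _ _ _) _; apply/bigmax_leqP => j _.
    by apply: leq_trans (size_scale_leq _ _) _; rewrite size_polyXn.
  apply/allP => x xrs; apply/rootP; rewrite horner_sum -[RHS](v0 x xrs).
  by apply: eq_bigr => j _; rewrite hornerZ hornerXn.
have := coef0 F (m i); rewrite -P0 coef_sum (bigD1 i) //= coefZ coefXn eqxx.
rewrite mulr1 big1 ?addr0 // => j ne_ji.
by rewrite coefZ coefXn (inj_eq m_inj) eq_sym (negPf ne_ji) mulr0.
Qed.

Lemma exprD_pchar_pow (R : comNzRingType) (r k : nat) (x y : R) :
  r \in [pchar R] -> (x + y) ^+ (r ^ k) = x ^+ (r ^ k) + y ^+ (r ^ k).
Proof.
move=> rR; apply: exprDn_pchar; rewrite pnatX; apply/orP; left.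
by rewrite pnatE ?(pcharf_prime rR).
Qed.

Lemma expr_sum_pchar_pow (R : comNzRingType) (r k : nat) (I : finType)
    (F : I -> R) :
  r \in [pchar R] -> (\sum_i F i) ^+ (r ^ k) = \sum_i F i ^+ (r ^ k).
Proof.
move=> rR; apply: (big_morph (fun x => x ^+ (r ^ k))) => [x y|].
  exact: exprD_pchar_pow.
by rewrite expr0n expn_eq0 -leqn0 leqNgt prime_gt0 ?(pcharf_prime rR).
Qed.

Lemma Fp_expr_pow (r k : nat) (a : 'F_r) : prime r -> a ^+ (r ^ k) = a.
Proof.
move=> r_pr; elim: k => [|k IHk]; first by rewrite expn0 expr1.
have ar : a ^+ r = a by have := expf_card a; rewrite card_Fp.
by rewrite expnS exprM ar.
Qed.

(* [e] is a basis over ['F_r] of the subfield of order [r ^ t]. *)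
Lemma trace_field (r t s : nat) : prime r -> (0 < t)%N -> (0 < s)%N ->
  exists (L : finFieldType) (f : {rmorphism 'F_r -> L}) (e : 'I_t -> L),
    [/\ #|L| = (r ^ (t * s))%N,
        forall c : 'I_t -> 'F_r, \sum_j f (c j) * e j = 0 -> forall j, c j = 0
      & forall x : L, exists c : 'I_t -> 'F_r,
          \sum_(l < s) x ^+ (r ^ (t * l)) = \sum_j f (c j) * e j].
Proof.
move=> r_pr t_gt0 s_gt0.
have ts_gt0 : (0 < t * s)%N by rewrite muln_gt0 t_gt0.
have r_gt1 := prime_gt1 r_pr.
have [L0 charL0 cardL0] := pPrimePowerField r_pr ts_gt0.
pose L : finFieldType := pPrimeCharType charL0.
have charL : r \in [pchar L] by [].
have cardL : #|L| = (r ^ (t * s))%N by [].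
(* [L] and [LV] share one carrier, seen as a finite field and as an ['F_r]-space. The map [tr] is
   the trace to the subfield of order [r ^ t]. *)
pose LV : fieldExtType 'F_r := pPrimeCharType charL0.
pose tr (x : LV) : LV := \sum_(l < s) x ^+ (r ^ (t * l)).
have tr_lin : linear tr.
  move=> a x y; rewrite /tr scaler_sumr -big_split; apply: eq_bigr => l _ /=.
  rewrite (exprD_pchar_pow _ _ _ charL) exprZn.
  by rewrite Fp_expr_pow.
pose trM := GRing.isLinear.Build 'F_r LV LV _ tr tr_lin.
pose trL : {linear LV -> LV} := HB.pack tr trM.
pose g := linfun trL.
have gE x : g x = tr x by rewrite lfunE.
have cardV (V : {vspace LV}) : #|[pred x : L | x \in V]| = (r ^ \dim V)%N.
  by have := @card_vspace _ L _ V; rewrite card_Fp.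
have dimL : \dim {: LV} = (t * s)%N.
  apply: (@expnI r) => //; rewrite -cardV -cardL; apply: eq_card => x.
  by rewrite !inE memvf.
(* The kernel consists of roots of a polynomial of degree [r ^ (t * s.-1)]. *)
have dim_ker : (\dim (lker g) <= t * s.-1)%N.
  rewrite -(leq_exp2l _ _ r_gt1) -cardV leqNgt; apply/negP => lt_ker.
  suff : (1 : L) = 0 by apply/eqP; rewrite oner_eq0.
  apply: (@sparse_poly_eq0 _ 'I_s (fun l => r ^ (t * l))%N (fun=> 1)
    (enum [pred x : L | x \in lker g])) (Ordinal s_gt0).
  - move=> i j /(expnI r_gt1)/eqP; rewrite eqn_pmul2l // => /eqP.
    exact: val_inj.
  - move=> i; rewrite -cardE; apply: leq_ltn_trans lt_ker.
    by rewrite leq_exp2l // leq_pmul2l // -ltnS prednK.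
  - exact: enum_uniq.
  move=> x; rewrite mem_enum inE memv_ker gE => /eqP trx.
  by under eq_bigr do rewrite mul1r.
(* The power map shifts the conjugates cyclically, the last one becoming [x ^+ #|L| = x]. *)
have tr_fix x : tr x ^+ (r ^ t) = tr x.
  rewrite (expr_sum_pchar_pow _ _ charL).
  under eq_bigr do rewrite -exprM -expnD -mulnSr.
  rewrite /tr; case: (s) s_gt0 cardL => // s' _ cardL.
  rewrite big_ord_recr big_ord_recl /= addrC -cardL; congr (_ + _).
  by rewrite muln0 expr1 (@expf_card L).
(* By [tr_fix] the image consists of roots of [X^(r^t) - X]; [bool] indexes its two terms. *)
have dim_img : (\dim (limg g) <= t)%N.
  rewrite -(leq_exp2l _ _ r_gt1) -cardV leqNgt; apply/negP => lt_img.
  suff : (1 : L) = 0 by apply/eqP; rewrite oner_eq0.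
  apply: (@sparse_poly_eq0 _ bool (fun b => if b then r ^ t else 1)%N
    (fun b => if b then 1 else -1)
    (enum [pred x : L | x \in limg g])) true.
  - have ne : (r ^ t != 1)%N by rewrite -(expn0 r) eqn_exp2l // -lt0n.
    by case=> [] [] // /eqP; rewrite ?(negPf ne) // eq_sym (negPf ne).
  - move=> b; rewrite -cardE; apply: leq_ltn_trans lt_img.
    by case: b => //; rewrite expn_gt0 ltnW.
  - exact: enum_uniq.
  move=> x; rewrite mem_enum inE => /memv_imgP[y _ ->].
  by rewrite big_bool /= gE tr_fix expr1 mul1r mulN1r subrr.
(* By rank-nullity the bound on the kernel forces the image to have dimension at least [t]. *)
have dimV : \dim (limg g) = t.
  apply/eqP; rewrite eqn_leq dim_img /=.
  have := limg_ker_dim g fullv; rewrite capfv dimL => dimE.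
  rewrite -(leq_add2l (t * s.-1)) -mulnSr prednK // -dimE leq_add2r.
  exact: dim_ker.
have [e [e_free e_span]] : exists e : t.-tuple LV, free e /\
    forall v, v \in limg g -> exists c : 'I_t -> 'F_r, v = \sum_j c j *: e`_j.
  rewrite -dimV; exists (vbasis (limg g)); split.
    exact: basis_free (vbasisP _).
  by move=> v /coord_vbasis ->; exists (fun i => coord (vbasis (limg g)) i v).
have alg_scale a (x : LV) : (a%:A : L) * x = a *: x by rewrite mulr_algl.
exists L, (GRing.in_alg LV : {rmorphism _ -> _}), (fun j => e`_j).
split=> [//|c c0|x].
  apply: (freeP e_free) => /=; rewrite -[RHS]c0.
  by apply: eq_bigr => j _; rewrite -alg_scale.
have [|c cE] := e_span (g x); first exact: memv_img (memvf x).
exists c; rewrite -/(tr x) -gE cE.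
by apply: eq_bigr => j _; rewrite -alg_scale.
Qed.

End LinearisedPolynomials.

(** * Fourier transform on ['F_p], quadratic character and square root bound *)

Section SquareRootBound.
Set Implicit Arguments. Unset Strict Implicit.
Import GRing.Theory.
Local Open Scope ring_scope.

Variables (L : fieldType) (p : nat) (w : L).
Hypotheses (p_pr : prime p) (w_prim : p.-primitive_root w).
Implicit Types (c : 'F_p -> L) (i j k : 'F_p).

Definition zeta_pow i : L := w ^+ i.
Local Notation z := zeta_pow.

Lemma zeta_powD i j : z (i + j) = z i * z j.
Proof. exact: prim_root_expFpD. Qed.

Lemma zeta_pow0 : z 0 = 1. Proof. by []. Qed.

Lemma zeta_powM i m : z i ^+ m = z (i * m%:R).
Proof.
elim: m => [|m IHm]; first by rewrite mulr0 zeta_pow0.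
by rewrite exprS IHm -zeta_powD mulrS mulrDr mulr1.
Qed.

Lemma zeta_pow_eq1 i : (z i == 1) = (i == 0).
Proof. exact: prim_root_expFp_eq1. Qed.

Lemma sum_zeta_pow j : \sum_i z (i * j) = if j == 0 then p%:R else 0.
Proof.
case: eqP => [->|/eqP nzj].
  under eq_bigr do rewrite mulr0 zeta_pow0.
  by rewrite sumr_const card_Fp.
pose S := \sum_i z (i * j); have : S = z j * S.
  rewrite {1}/S (reindex_inj (addrI 1)) mulr_sumr; apply: eq_bigr => i _.
  by rewrite mulrDl mul1r zeta_powD.
rewrite -/S => /eqP; rewrite -subr_eq0 -{1}[S]mul1r -mulrBl mulf_eq0.
by rewrite subr_eq0 eq_sym zeta_pow_eq1 (negPf nzj) => /eqP ->.
Qed.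

(** This is the value at [w ^+ j] of the polynomial with coefficients [c], so its zeros are the
    zeros of a cyclic code. *)
Definition fourier c j : L := \sum_i c i * z (i * j).

Lemma fourier0 c : fourier c 0 = \sum_i c i.
Proof. by apply: eq_bigr => i _; rewrite mulr0 zeta_pow0 mulr1. Qed.

Lemma eq_fourier c c' : c =1 c' -> fourier c =1 fourier c'.
Proof. by move=> cc j; apply: eq_bigr => i _; rewrite cc. Qed.

Lemma fourierB c c' j :
  fourier (fun i => c i - c' i) j = fourier c j - fourier c' j.
Proof. by rewrite -sumrB; apply: eq_bigr => i _; rewrite mulrBl. Qed.

Lemma fourier_inv c k : \sum_j fourier c j * z (- k * j) = p%:R * c k.
Proof.
rewrite /fourier; under eq_bigr do rewrite mulr_suml.
rewrite exchange_big /= (bigD1 k) //= [X in _ + X]big1 ?addr0 => [|i ne_ik].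
  under eq_bigr do rewrite -mulrA -zeta_powD -mulrDl subrr mul0r zeta_pow0 mulr1.
  by rewrite sumr_const card_Fp // mulr_natl.
transitivity (c i * \sum_j z (j * (i - k))); last first.
  by rewrite sum_zeta_pow subr_eq0 (negPf ne_ik) mulr0.
rewrite mulr_sumr; apply: eq_bigr => j _.
by rewrite -mulrA -zeta_powD -mulrDl [j * _]mulrC.
Qed.

(* The cyclic convolution [h] of [c] with its dilation by [u] has Fourier
   transform supported at [0], so it is a nonzero constant and the supports
   of [c] and of its dilation add up to all of ['F_p]. *)
Lemma square_root_bound c u : fourier c 0 != 0 ->
    (forall j, j != 0 -> fourier c j = 0 \/ fourier c (u * j) = 0) ->
  (p <= #|[set i | c i != 0%R]| ^ 2)%N.
Proof.
move=> c0 cu; set A := [set i | _].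
pose h k := \sum_i c (k - u * i) * c i.
have hE j : fourier h j = fourier c j * fourier c (u * j).
  rewrite /fourier; under eq_bigr do rewrite mulr_suml.
  rewrite exchange_big mulr_sumr; apply: eq_bigr => i _ /=.
  (* Shifting [k] by [u * i] splits the double sum into a product. *)
  rewrite (reindex_inj (addIr (u * i))) mulr_suml; apply: eq_bigr => k _ /=.
  by rewrite addrK mulrDl zeta_powD [u * i]mulrC -[i * u * j]mulrA; ring.
have h_neq0 k : h k != 0.
  have := fourier_inv h k.
  rewrite (bigD1 0) //= [X in _ + X]big1 ?addr0 => [|j nzj].
    rewrite mulr0 zeta_pow0 mulr1 hE mulr0 => hk.
    by apply: contraNneq c0 => hk0; move/eqP: hk; rewrite hk0 mulr0 mulf_eq0 orbb.
  by rewrite hE; case: (cu j nzj) => ->; rewrite ?mul0r ?mulr0 ?mul0r.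
rewrite -{1}(card_Fp p_pr) -cardsT -mulnn -cardsX.
apply: leq_trans (leq_imset_card (fun x => x.1 + u * x.2) _).
apply: subset_leq_card; apply/subsetP => k _.
have [i ci] : exists i, c (k - u * i) * c i != 0.
  apply/existsP; apply: contraNT (h_neq0 k).
  rewrite negb_exists => /forallP ci; apply/eqP; rewrite /h big1 // => i _.
  by apply/eqP; rewrite -[_ == _]negbK ci.
move: ci; rewrite mulf_eq0 negb_or => /andP[ci1 ci2].
by apply/imsetP; exists (k - u * i, i); rewrite ?inE ?ci1 ?ci2 //= subrK.
Qed.

(** Euler's criterion makes this the Legendre symbol, with values 0, 1 and -1 taken in ['F_p]. *)
Definition qchar i : 'F_p := i ^+ (p.-1./2).

Lemma qcharM i j : qchar (i * j) = qchar i * qchar j.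
Proof. exact: exprMn. Qed.

Hypothesis p_odd : odd p.

Lemma half_pred_gt0 : (0 < p.-1./2)%N.
Proof.
case: p p_odd (prime_gt1 p_pr) => [|[|[|m]]] // _ _.
Qed.

Lemma qchar0 : qchar 0 = 0.
Proof. by rewrite /qchar expr0n -leqn0 leqNgt half_pred_gt0. Qed.

Lemma double_half_pred : (p.-1./2 * 2 = p.-1)%N.
Proof.
rewrite muln2; have := odd_double_half p.-1; move: p_odd.
by case: p (prime_gt0 p_pr) => //= m _ /negPf ->.
Qed.

Lemma Fp_expr_pred i : i != 0 -> i ^+ p.-1 = 1.
Proof.
move=> nzi; apply: (mulfI nzi); rewrite -exprS prednK ?prime_gt0 // mulr1.
by have := expf_card i; rewrite card_Fp.
Qed.

Lemma qchar_sqr i : i != 0 -> qchar (i ^+ 2) = 1.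
Proof.
by move=> nzi; rewrite /qchar -exprM mulnC double_half_pred Fp_expr_pred.
Qed.

Lemma qchar_sign i : i != 0 -> qchar i = 1 \/ qchar i = -1.
Proof.
move=> nzi; have /eqP : qchar i ^+ 2 = 1.
  by rewrite -exprM double_half_pred Fp_expr_pred.
by rewrite sqrf_eq1 => /orP[]/eqP; [left|right].
Qed.

Lemma Fp_opp1_neq1 : -1 != 1 :> 'F_p.
Proof.
rewrite -subr_eq0 -opprD oppr_eq0 -(natrD _ 1 1) -(dvdn_pcharf (pchar_Fp p_pr)).
apply/negP => /(@dvdn_leq p 2 isT); move: p_odd (prime_gt1 p_pr).
by case: p => [|[|[|]]].
Qed.

(** Otherwise all [p.-1] nonzero elements would be roots of a polynomial of degree [p.-1./2]. *)
Lemma exists_nonresidue : exists u, qchar u = -1.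
Proof.
have [/existsP[u /eqP]|/existsPn noN] := boolP [exists u, qchar u == -1].
  by exists u.
pose rs := enum [pred i : 'F_p | i != 0].
have sz_rs : size rs = p.-1.
  by rewrite -cardE (cardC1 (0 : 'F_p)) card_Fp.
have nzP : ('X^(p.-1./2) - 1 : {poly 'F_p}) != 0.
  by rewrite -size_poly_gt0 size_XnsubC ?half_pred_gt0.
have rsP : all (root ('X^(p.-1./2) - 1)) rs.
  apply/allP => i; rewrite mem_enum inE => nzi.
  rewrite rootE !hornerE subr_eq0; case: (qchar_sign nzi) => [/eqP//|/eqP].
  by rewrite (negPf (noN i)).
have := max_poly_roots nzP rsP (enum_uniq _).
rewrite sz_rs size_XnsubC ?half_pred_gt0 // ltnS leqNgt.
by rewrite -[X in (_ < X)%N]double_half_pred muln2 -addnn -ltn_subLR ?subnn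
  ?half_pred_gt0.
Qed.

(** Multiplication by a nonresidue [u] swaps the two quadratic classes, so one of [j] and [u * j]
    lies in the class of [v]. *)
Lemma residue_class_bound c v : v != 0 -> fourier c 0 != 0 ->
    (forall j, qchar j = qchar v -> fourier c j = 0) ->
  (p <= #|[set i | c i != 0%R]| ^ 2)%N.
Proof.
move=> nzv c0 cv; have [u u1] := exists_nonresidue.
apply: (@square_root_bound c u) => // j nzj.
have [eq_jv|ne_jv] := eqVneq (qchar j) (qchar v); first by left; apply: cv.
right; apply: cv; rewrite qcharM u1 mulN1r.
move: ne_jv; case: (qchar_sign nzj) => ->; case: (qchar_sign nzv) => -> //;
  by rewrite ?eqxx ?opprK.
Qed.

End SquareRootBound.

(** * The two quadratic residue codes and their distances *)

Section QuadraticResidueCode.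
Set Implicit Arguments. Unset Strict Implicit.
Import GRing.Theory.
Local Open Scope ring_scope.

Variables (p r t s : nat).
Hypotheses (p_pr : prime p) (p_odd : odd p) (r_pr : prime r).
Hypotheses (t_gt0 : (0 < t)%N) (s_gt0 : (0 < s)%N).
Hypothesis r_neq0 : r%:R != 0 :> 'F_p.
Hypothesis p_neq0 : p%:R != 0 :> 'F_r.
Hypothesis q_residue : qchar ((r ^ t)%:R : 'F_p) = 1.

Variables (L : finFieldType) (f : {rmorphism 'F_r -> L}) (e : 'I_t -> L) (w : L).
Hypothesis cardL : #|L| = (r ^ (t * s))%N.
Hypothesis e_free : forall c : 'I_t -> 'F_r,
  \sum_j f (c j) * e j = 0 -> forall j, c j = 0.
Hypothesis e_span : forall x : L, exists c : 'I_t -> 'F_r,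
  \sum_(l < s) x ^+ (r ^ (t * l)) = \sum_j f (c j) * e j.
Hypothesis w_prim : p.-primitive_root w.

Variables (pos : 'I_t * 'F_p -> 'I_(t * p)) (pos_inv : 'I_(t * p) -> 'I_t * 'F_p).
Hypotheses (posK : cancel pos pos_inv) (pos_invK : cancel pos_inv pos).

Local Notation state := (qstate (t * p) r).
Local Notation z := (zeta_pow w).
Implicit Types (b x y : state) (i : 'F_p).

Let charL : r \in [pchar L].
Proof. by rewrite (fmorph_pchar f) pchar_Fp. Qed.

Let pL_neq0 : p%:R != 0 :> L.
Proof. by rewrite -(rmorph_nat f) fmorph_eq0. Qed.

Let zD (i j : 'F_p) : z (i + j) = z i * z j.
Proof. exact: zeta_powD. Qed.

Lemma sum_state (R : nmodType) (F : 'I_(t * p) -> R) :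
  \sum_k F k = \sum_i \sum_j F (pos (j, i)).
Proof.
rewrite exchange_big pair_big /= (reindex pos); last first.
  by exists pos_inv => ? _.
by apply: eq_bigr => -[].
Qed.

Definition word x i : L := \sum_(j < t) f (x (pos (j, i))) * e j.

Lemma wordB x y i : word (x - y) i = word x i - word y i.
Proof.
rewrite /word -sumrB; apply: eq_bigr => j _.
by rewrite -mulrBl -rmorphB !ffunE.
Qed.

(** Each place where [c] is nonzero contains a nonzero coordinate of [x]. The word [c] is left
    general to cover both [word x] and the coefficient words of a functional. *)
Lemma support_le_wt x (c : 'F_p -> L) :
    (forall i, (forall j, x (pos (j, i)) = 0) -> c i = 0) ->
  (#|[set i | c i != 0%R]| <= wt x)%N.
Proof.
move=> cx; apply: leq_trans (leq_imset_card (fun k => (pos_inv k).2) _).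
apply: subset_leq_card; apply/subsetP => i; rewrite inE => ci.
have [j xj] : exists j, x (pos (j, i)) != 0.
  apply/existsP; apply: contraNT ci; rewrite negb_exists => /forallP xi.
  by apply/eqP; apply: cx => j; apply/eqP; rewrite -[_ == _]negbK xi.
by apply/imsetP; exists (pos (j, i)); rewrite ?inE // posK.
Qed.

Definition qr_even x := [forall i, (qchar i == 1) ==> (fourier w (word x) i == 0)].
Definition code1 : {set state} := [set x | qr_even x].
Definition code2 : {set state} :=
  [set x in code1 | fourier w (word x) 0 == 0].

Lemma fourier_wordB x y i :
  fourier w (word (x - y)) i = fourier w (word x) i - fourier w (word y) i.
Proof. by rewrite -fourierB; apply: eq_fourier => k; rewrite wordB. Qed.

Lemma code1P x :
  reflect (forall i, qchar i = 1 -> fourier w (word x) i = 0) (x \in code1).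
Proof.
rewrite inE; apply: (iffP forallP) => h i; last first.
  by apply/implyP => /eqP /h ->.
by move=> qi; apply/eqP; apply: (implyP (h i)); rewrite qi.
Qed.

Lemma code1B x y : x \in code1 -> y \in code1 -> x - y \in code1.
Proof.
move=> /code1P hx /code1P hy; apply/code1P => i qi.
by rewrite fourier_wordB hx // hy // subrr.
Qed.

Lemma code2B x y : x \in code2 -> y \in code2 -> x - y \in code2.
Proof.
rewrite ![_ \in code2]inE => /andP[hx /eqP x0] /andP[hy /eqP y0].
by rewrite fourier_wordB x0 y0 subrr eqxx andbT code1B.
Qed.

Lemma code20 : 0 \in code2.
Proof.
have w0 i : word 0 i = 0.
  by rewrite /word big1 // => j _; rewrite ffunE rmorph0 mul0r.
have f0 i : fourier w (word 0) i = 0.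
  by rewrite /fourier big1 // => j _; rewrite w0 mul0r.
by rewrite inE f0 eqxx andbT; apply/code1P.
Qed.

(** The same block [m] is repeated at every place; these [r ^ t] states represent the cosets of
    [code2] in [code1]. *)
Definition const_state (m : {ffun 'I_t -> 'F_r}) : state :=
  [ffun k => m (pos_inv k).1].

Lemma const_stateB m m' :
  const_state m - const_state m' = const_state (m - m').
Proof. by apply/ffunP => k; rewrite !ffunE. Qed.

Lemma fourier_const_state m i : fourier w (word (const_state m)) i =
  if i == 0 then (\sum_j f (m j) * e j) * p%:R else 0.
Proof.
transitivity ((\sum_j f (m j) * e j) * \sum_k z (k * i)).
  rewrite mulr_sumr; apply: eq_bigr => k _; congr (_ * _).
  by apply: eq_bigr => j _; rewrite ffunE posK.
by rewrite sum_zeta_pow //; case: eqP; rewrite ?mulr0.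
Qed.

Lemma qchar_neq0 i : qchar i = 1 -> i != 0.
Proof.
by move=> qi; apply: contra_eqN qi => /eqP->; rewrite qchar0 // eq_sym oner_eq0.
Qed.

Lemma const_state_code1 m : const_state m \in code1.
Proof.
by apply/code1P => i /qchar_neq0/negPf i0; rewrite fourier_const_state i0.
Qed.

Lemma const_state_inj m m' :
  const_state m - const_state m' \in code2 -> m = m'.
Proof.
rewrite const_stateB inE fourier_const_state eqxx mulf_eq0 (negPf pL_neq0) orbF.
case/andP=> _ /eqP/e_free m0; apply/ffunP => j.
by apply/eqP; rewrite -subr_eq0; have := m0 j; rewrite !ffunE => ->.
Qed.

Lemma code1_distance x : x \in code1 -> (wt x ^ 2 < p)%N -> x \in code2.
Proof.
move=> xC wx; rewrite inE xC /=; apply: contraLR wx => x0.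
rewrite -leqNgt; apply: leq_trans (_ : #|[set i | word x i != 0%R]| ^ 2 <= _)%N.
  apply: (@residue_class_bound _ _ w) (oner_neq0 _) x0 _ => // i.
  by rewrite {2}/qchar expr1n; apply/code1P.
rewrite leq_exp2r //; apply: support_le_wt => i xi.
by rewrite /word big1 // => j _; rewrite xi rmorph0 mul0r.
Qed.

(** A kernel vector gives a linearised polynomial of degree below [r ^ t] vanishing at each [e j],
    hence on their ['F_r]-span, which has [r ^ t] elements. *)
Lemma moore_unitmx : \matrix_(j < t, k < t) e j ^+ (r ^ k) \in unitmx.
Proof.
have r_gt1 := prime_gt1 r_pr.
rewrite -unitmx_tr -row_free_unit; apply: inj_row_free => v v0.
apply/rowP => k; rewrite mxE; move: k.
pose el (c : {ffun 'I_t -> 'F_r}) := \sum_j f (c j) * e j.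
have el_inj : injective el.
  move=> c c' /eqP; rewrite -subr_eq0 /el -sumrB => /eqP cc.
  apply/ffunP => j; apply/eqP; rewrite -subr_eq0; apply/eqP.
  have := @e_free (fun j => c j - c' j); apply; rewrite -[RHS]cc.
  by apply: eq_bigr => k _; rewrite rmorphB mulrBl.
apply: (@sparse_poly_eq0 _ _ (fun k : 'I_t => r ^ k)%N _ (codom el)).
- by move=> k k' /(expnI r_gt1)/val_inj.
- by move=> k; rewrite size_codom card_ffun card_Fp // card_ord ltn_exp2l.
- by rewrite map_inj_uniq ?enum_uniq.
move=> _ /codomP[c ->].
under eq_bigr do rewrite expr_sum_pchar_pow // mulr_sumr.
rewrite exchange_big big1 //= => j _.
have /rowP/(_ j) := v0; rewrite !mxE => vj.
transitivity (f (c j) * \sum_k v 0 k * e j ^+ (r ^ k)).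
  rewrite mulr_sumr; apply: eq_bigr => k _.
  by rewrite exprMn -rmorphXn Fp_expr_pow // mulrCA.
rewrite -[X in _ * X](_ : 0 = _) ?mulr0 // -[LHS]vj; apply: eq_bigr => k _.
by rewrite !mxE.
Qed.

(** The transform of the [l]-th conjugate is supported at [n * (r ^ (t * l))%:R]. This is a
    nonresidue because [r ^ t] is a residue, so the transform vanishes at 0 and at all residues. *)
Lemma code2_trace (n : 'F_p) (x : L) : qchar n = -1 ->
  exists2 y, y \in code2 &
    forall i, word y i = \sum_(l < s) (x * z (- (n * i))) ^+ (r ^ (t * l)).
Proof.
move=> qn.
have [c cE] := fin_all_exists (fun i : 'F_p => e_span (x * z (- (n * i)))).
pose y : state := [ffun k => c (pos_inv k).2 (pos_inv k).1].
have yE i : word y i = \sum_(l < s) (x * z (- (n * i))) ^+ (r ^ (t * l)).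
  by rewrite cE; apply: eq_bigr => j _; rewrite ffunE posK.
exists y => //.
suff y0 i : i = 0 \/ qchar i = 1 -> fourier w (word y) i = 0.
  rewrite inE y0 ?eqxx ?andbT; last by left.
  by apply/code1P => i qi; apply: y0; right.
move=> hi; rewrite (eq_fourier w yE) /fourier.
under eq_bigr do rewrite mulr_suml.
rewrite exchange_big big1 //= => l _.
transitivity (x ^+ (r ^ (t * l)) * \sum_k z (k * (i - n * (r ^ (t * l))%:R))).
  rewrite mulr_sumr; apply: eq_bigr => k _.
  rewrite exprMn zeta_powM // -mulrA -zD; congr (_ * z _).
  by rewrite mulrBr addrC mulNr mulrA [k * n]mulrC.
rewrite sum_zeta_pow // subr_eq0; case: eqP => [iE|_]; last by rewrite mulr0.
have qi : qchar i = -1.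
  rewrite iE qcharM qn expnM natrX /qchar exprAC -/(qchar _) q_residue.
  by rewrite expr1n mulr1.
have := Fp_opp1_neq1 p_pr p_odd; rewrite -qi.
case: hi => [i0|->]; last by rewrite eqxx.
by move: qi; rewrite i0 qchar0 // => /eqP; rewrite eq_sym oppr_eq0 oner_eq0.
Qed.

(** The conclusion says that [b] kills the constant states. If it failed, some coefficient word
    [beta k0] would have a nonzero transform at 0 while vanishing on a quadratic class, and its
    support would bound the weight of [b] from below. *)
Lemma code2_dual_sum b : (forall x, x \in code2 -> dotF b x = 0) ->
  (wt b ^ 2 < p)%N -> forall j, \sum_i b (pos (j, i)) = 0.
Proof.
move=> b0 wb j0; apply/eqP; apply: contraLR wb => bj0; rewrite -leqNgt.
have r_gt1 := prime_gt1 r_pr.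
set M := \matrix_(j < t, k < t) e j ^+ (r ^ k).
(* Inverting the Moore matrix writes [b] at place [i] as the linearised polynomial with coefficients
   [beta k i]. *)
pose beta k i := \sum_j invmx M k j * f (b (pos (j, i))).
have betaE i j : \sum_k beta k i * e j ^+ (r ^ k) = f (b (pos (j, i))).
  pose B := \col_j f (b (pos (j, i))).
  have := mulKVmx moore_unitmx B => /colP/(_ j); rewrite [RHS]mxE => <-.
  rewrite mxE; apply: eq_bigr => k _; rewrite !mxE mulrC; congr (_ * _).
  by apply: eq_bigr => l _; rewrite !mxE.
have [k0 beta0] : exists k, fourier w (beta k) 0 != 0.
  apply/existsP; apply: contraNT bj0; rewrite negb_exists => /forallP bk.
  rewrite -(fmorph_eq0 f) rmorph_sum; apply/eqP.
  under eq_bigr do rewrite -betaE.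
  rewrite exchange_big big1 //= => k _; rewrite -mulr_suml -(fourier0 w).
  by move/eqP: (negbNE (bk k)) => ->; rewrite mul0r.
apply: leq_trans (_ : #|[set i | beta k0 i != 0%R]| ^ 2 <= _)%N; last first.
  rewrite leq_exp2r //; apply: support_le_wt => i bi.
  by rewrite /beta big1 // => j _; rewrite bi rmorph0 mulr0.
have [u qu] := exists_nonresidue p_pr p_odd.
have u_neq0 : u != 0.
  by apply: contra_eqN qu => /eqP->; rewrite qchar0 // eq_sym oppr_eq0 oner_eq0.
have rk_neq0 : (r ^ k0)%:R != 0 :> 'F_p by rewrite natrX expf_neq0.
(* Only [r ^ t] is known to be a residue, so the class depends on [r ^ k0]; with
   [i = - (n * r ^ k0)], it is the one that makes [n] a nonresidue. *)
apply: (@residue_class_bound _ _ w p_pr w_prim p_odd _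
  (- (u * (r ^ k0)%:R))) => //.
  by rewrite oppr_eq0 mulf_neq0.
move=> i qi; pose n := - i / (r ^ k0)%:R.
have iE : i = - (n * (r ^ k0)%:R) by rewrite divfK // opprK.
have qn : qchar n = -1.
  have q_neq0 : qchar (- (r ^ k0)%:R : 'F_p) != 0.
    by rewrite expf_neq0 // oppr_eq0.
  apply: (mulIf q_neq0); rewrite -qu -!qcharM.
  by rewrite mulrN -iE qi mulrN.
(* Testing [b] against the traces of all multiples [x] of one character gives
   a polynomial identity in [x] of degree smaller than [#|L|]. *)
pose ex (kl : 'I_t * 'I_s) := (r ^ (t * kl.2 + kl.1))%N.
have := @sparse_poly_eq0 L _ ex
  (fun kl => \sum_i beta kl.1 i * z (- (n * i) * (ex kl)%:R)) (enum L).
move=> /(_ _ _ (enum_uniq _) _ (k0, Ordinal s_gt0)) H.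
rewrite /fourier -[RHS]H => [|||x _].
- apply: eq_bigr => k _; congr (_ * z _); rewrite /ex /= muln0 add0n iE.
  by rewrite mulrN mulNr mulrCA mulrA.
(* Division by [t] recovers [l] as quotient and [k] as remainder. *)
- move=> [k l] [k' l'] /(expnI r_gt1) /= E.
  have Ek : k = k' :> nat.
    have := congr1 (modn^~ t) E.
    by rewrite /= ![(t * _)%N]mulnC !modnMDl !modn_small.
  have El : l = l' :> nat.
    by move/eqP: E; rewrite Ek eqn_add2r eqn_pmul2l // => /eqP.
  by congr (_, _); apply: val_inj.
- move=> [k l]; rewrite -cardE cardL ltn_exp2l //=.
  apply: (@leq_trans (t * l + t)); first by rewrite ltn_add2l.
  by rewrite -mulnSr leq_pmul2l.
have [y yC yE] := code2_trace x qn.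
transitivity (f (dotF b y)); last by rewrite b0 ?rmorph0.
rewrite /dotF sum_state rmorph_sum /=.
under eq_bigr do rewrite mulr_suml.
rewrite exchange_big; apply: eq_bigr => k _ /=.
rewrite rmorph_sum; under [RHS]eq_bigr do rewrite rmorphM -betaE mulr_suml.
rewrite exchange_big /= -(pair_big xpredT xpredT (fun k' l =>
  beta k' k * z (- (n * k) * (ex (k', l))%:R) * x ^+ ex (k', l))) /=.
apply: eq_bigr => k' _.
(* Frobenius fixes the coordinates of [y], so the linearised polynomial at [word y k] computes the
   contribution of place [k] to [dotF b y]. *)
transitivity (beta k' k * word y k ^+ (r ^ k')).
  rewrite yE expr_sum_pchar_pow // mulr_sumr; apply: eq_bigr => l _.
  by rewrite -exprM -expnD exprMn zeta_powM // -mulrA; congr (_ * _); rewrite mulrC.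
rewrite expr_sum_pchar_pow // mulr_sumr; apply: eq_bigr => j _.
by rewrite exprMn -rmorphXn Fp_expr_pow // -!mulrA; congr (_ * _); rewrite mulrC.
Qed.

Lemma code2_dual_distance b : (forall x, x \in code2 -> dotF b x = 0) ->
  (wt b ^ 2 < p)%N -> forall x, x \in code1 -> dotF b x = 0.
Proof.
move=> b0 wb x xC; have bs := code2_dual_sum b0 wb.
have b_const m : dotF b (const_state m) = 0.
  rewrite /dotF sum_state exchange_big big1 //= => j _.
  under eq_bigr do rewrite ffunE posK /=.
  by rewrite -mulr_suml bs mul0r.
(* Subtracting the mean block makes the transform vanish at 0, so [x] is a constant state plus an
   element of [code2]. *)
pose m := [ffun j => (\sum_i x (pos (j, i))) / p%:R].
have xmC : x - const_state m \in code2.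
  rewrite inE code1B ?const_state_code1 // fourier_wordB fourier_const_state eqxx.
  rewrite fourier0 /word exchange_big mulr_suml -sumrB big1 //= => j _.
  rewrite -mulr_suml -rmorph_sum ffunE mulrAC -(rmorph_nat f) -rmorphM divfK //.
  by rewrite subrr.
have -> : dotF b x = dotF b (x - const_state m) + dotF b (const_state m).
  by rewrite -big_split; apply: eq_bigr => k _ /=; rewrite -mulrDr !ffunE subrK.
by rewrite b0 // b_const addr0.
Qed.

End QuadraticResidueCode.

(** * Choice of the field and the distance, and assembly of the code *)

Section Existence.
Set Implicit Arguments. Unset Strict Implicit.
Import GRing.Theory.
Local Open Scope ring_scope.

Lemma finField_prim_root (F : finFieldType) (n : nat) :
  (n %| #|F|.-1)%N -> exists w : F, n.-primitive_root w.
Proof.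
have F_gt1 := finNzRing_gt1 F.
have F_gt0 : (0 < #|F|.-1)%N by rewrite -ltnS prednK // ltnW.
pose rs := enum [pred x : F | x != 0].
have rs_roots : all (#|F|.-1).-unity_root rs.
  apply/allP => x; rewrite mem_enum inE => nzx; apply/unity_rootP.
  by apply: (mulfI nzx); rewrite -exprS prednK ?mulr1 ?expf_card // ltnW.
have sz_rs : (#|F|.-1 <= size rs)%N by rewrite -cardE (cardC1 (0 : F)).
have /hasP[g _ g_prim] := has_prim_root F_gt0 rs_roots (enum_uniq _) sz_rs.
by move=> dvd_n; exists (g ^+ (#|F|.-1 %/ n)); apply: dvdn_prim_root.
Qed.

Lemma quadratic_residue_AQECC (p ps t : nat) :
  prime p -> odd p ->
  prime ps -> (0 < t)%N -> ~~ (p %| ps)%N ->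
  (exists x : nat, x ^ 2 = ps ^ t %[mod p])%N ->
  exists (dz dx : nat) (Q : 'M[algC]_#|{: qstate (t * p) ps}|),
    is_AQECC (t * p) t ps dz dx Q /\ (p <= dz * dz)%N /\ (p <= dx * dx)%N.
Proof.
move=> p_pr p_odd r_pr t_gt0 ndvd [x0 x0E].
have p1_gt0 : (0 < p.-1)%N by rewrite -ltnS prednK ?prime_gt1 ?prime_gt0.
have r_neq0 : ps%:R != 0 :> 'F_p by rewrite -(dvdn_pcharf (pchar_Fp p_pr)).
have p_neq0 : p%:R != 0 :> 'F_ps.
  rewrite -(dvdn_pcharf (pchar_Fp r_pr)) dvdn_prime2 //.
  by apply: contra ndvd => /eqP ->.
have q_res : qchar ((ps ^ t)%:R : 'F_p) = 1.
  have E : (x0%:R : 'F_p) ^+ 2 = (ps ^ t)%:R.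
    by rewrite -natrX -(Fp_nat_mod p_pr) x0E Fp_nat_mod.
  rewrite -E qchar_sqr //; apply: contraNneq r_neq0 => x00.
  by move/eqP: E; rewrite x00 expr0n eq_sym natrX expf_eq0 => /andP[].
have [L [f [e [cardL e_free e_span]]]] := trace_field r_pr t_gt0 p1_gt0.
(* With extension degree [p.-1], Fermat's little theorem gives that [p] divides [#|L| - 1]. *)
have [w w_prim] : exists w : L, p.-primitive_root w.
  apply: finField_prim_root; rewrite cardL -subn1 (dvdn_pcharf (pchar_Fp p_pr)).
  rewrite natrB ?expn_gt0 ?prime_gt0 // natrX mulnC exprM Fp_expr_pred //.
  by rewrite expr1n subrr.
have card_pos : #|{: 'I_t * 'F_p}| = (t * p)%N.
  by rewrite card_prod card_ord card_Fp.
pose pos (ji : 'I_t * 'F_p) := cast_ord card_pos (enum_rank ji).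
pose pos_inv (k : 'I_(t * p)) : 'I_t * 'F_p :=
  enum_val (cast_ord (esym card_pos) k).
have posK : cancel pos pos_inv.
  by move=> ji; rewrite /pos_inv /pos cast_ordK enum_rankK.
have pos_invK : cancel pos_inv pos.
  by move=> k; rewrite /pos_inv /pos enum_valK cast_ordKV.
(* The least such [d] is the square root of [p] rounded up, so a weight below [d] has square below
   [p]. *)
have [|d dP d_min] := @ex_minnP (fun d => p <= d * d)%N.
  by exists p; rewrite leq_pmulr ?prime_gt0.
have d_gt0 : (0 < d)%N.
  by rewrite lt0n; apply: contraTneq dP => ->; rewrite -ltnNge prime_gt0.
have d_lt m : (m < d)%N -> (m ^ 2 < p)%N.
  by rewrite -mulnn; case: (ltnP (m * m) p) => // /d_min; rewrite ltnNge => ->.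
exists d, d; suff [Q QP] : exists Q, is_AQECC (t * p) t ps d d Q by exists Q.
apply: (@css_code _ _ r_pr (code1 f e w pos) (code2 f e w pos) _ _ _ _
  t d d _ (const_state pos_inv)) => //.
- exact: code1B.
- exact: code2B.
- exact: code20.
- by apply/subsetP => x; rewrite inE => /andP[].
- by rewrite card_ffun card_Fp // card_ord.
- exact: const_state_code1.
- exact: const_state_inj.
- by move=> a aC /d_lt; apply: code1_distance aC.
by move=> b bC /d_lt; apply: (code2_dual_distance _ _ _ _ p1_gt0 _ _ _ cardL).
Qed.
End Existence.

Theorem theorem14 (p ps t : nat) :
  prime p -> p %% 4 = 1 ->
  prime ps -> (0 < t)%N -> ~~ (p %| ps) ->
  (exists x : nat, x ^ 2 = ps ^ t %[mod p]) ->
  exists (dz dx : nat) (Q : 'M[algC]_#|{: qstate (t * p) ps}|),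
    is_AQECC (t * p) t ps dz dx Q /\ (p <= dz * dz)%N /\ (p <= dx * dx)%N.
Proof.
move=> p_pr p4; apply: quadratic_residue_AQECC => //.
by rewrite (divn_eq p 4) p4 oddD oddM andbF.
Qed.
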